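(* Let $R$ be a commutative ring. Then the monoid $PC(R)=P(R)/F(R)$ is a group, and it is isomorphic to $K_0(R)/\langle [R]\rangle$, where $\langle [R]\rangle$ is the subgroup of $K_0(R)$ generated by the class $[R]$.
   Context: All monoids are commutative and written additively. If $N$ is a submonoid of a monoid $M$, then $M/N$ denotes the monoid of equivalence classes of $M$ under the relation $m_1\sim m_2$ iff there are $n_1,n_2\in N$ with $m_1+n_1=m_2+n_2$. $P(R)$ is the monoid of isomorphism classes of finitely generated projective $R$-modules, with operation induced by direct sum and identity the class of $0$. $F(R)$ is the submonoid of isomorphism classes of (finitely generated) free $R$-modules. $PC(R)=P(R)/F(R)$ is the projective class monoid of $R$. *)

(* Defs.v *)
From HB Require Import structures.
From mathcomp Require Import all_boot all_algebra ssrAC generic_quotient.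
From mathcomp Require Import boolp.

Set Implicit Arguments.
Unset Strict Implicit.
Unset Printing Implicit Defensive.

Import GRing.Theory.
Local Open Scope ring_scope.
Local Open Scope quotient_scope.

Section QuotientMonoid.
Variables (M : nmodType) (N : addrClosed M).

Definition mquo_rel (x y : M) : bool :=
  `[< exists n1 n2 : M, [/\ n1 \in N, n2 \in N & x + n1 = y + n2] >].

Lemma mquo_rel_equiv : equiv_class_of mquo_rel.
Proof.
split=> [x|x y|y x z].
- by apply/asboolP; exists 0, 0; split=> //; apply: rpred0.
- apply/asboolP/asboolP=> -[a [b [Na Nb e]]]; exists b, a; split=> //.
- move=> /asboolP[a [b [Na Nb e1]]] /asboolP[c [d [Nc Nd e2]]].
  apply/asboolP; exists (a + c), (d + b); split; [exact: rpredD..|].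
  by rewrite addrA e1 addrAC e2 addrA.
Qed.

Canonical mquo_equiv := EquivRelPack mquo_rel_equiv.
Canonical mquo_encModRel := defaultEncModRel mquo_rel.

Definition mquo := {eq_quot mquo_rel}.
HB.instance Definition _ := EqQuotient.on mquo.
HB.instance Definition _ := Choice.on mquo.

Definition mquo_pi (x : M) : mquo := \pi_mquo%qT x.

Lemma mquo_piP (x y : M) : mquo_pi x = mquo_pi y <->
  exists n1 n2 : M, [/\ n1 \in N, n2 \in N & x + n1 = y + n2].
Proof.
by split=> [/eqquotP/asboolP//|h]; apply/eqquotP/asboolP.
Qed.

Definition mquo_add (p q : mquo) : mquo := mquo_pi (repr p + repr q).

Lemma mquo_reprK (p : mquo) : mquo_pi (repr p) = p.
Proof. exact: reprK. Qed.

Lemma mquo_add_pi x y : mquo_add (mquo_pi x) (mquo_pi y) = mquo_pi (x + y).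
Proof.
have /mquo_piP[a [b [Na Nb e1]]] := mquo_reprK (mquo_pi x).
have /mquo_piP[c [d [Nc Nd e2]]] := mquo_reprK (mquo_pi y).
apply/mquo_piP; exists (a + c), (b + d); split; [exact: rpredD..|].
by rewrite addrACA e1 e2 addrACA.
Qed.

Lemma mquo_addA : associative mquo_add.
Proof.
move=> p q r; rewrite -(mquo_reprK p) -(mquo_reprK q) -(mquo_reprK r).
by rewrite !mquo_add_pi addrA.
Qed.

Lemma mquo_addC : commutative mquo_add.
Proof.
move=> p q; rewrite -(mquo_reprK p) -(mquo_reprK q).
by rewrite !mquo_add_pi addrC.
Qed.

Lemma mquo_add0 : left_id (mquo_pi 0) mquo_add.
Proof. by move=> p; rewrite -(mquo_reprK p) mquo_add_pi add0r. Qed.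

HB.instance Definition _ :=
  GRing.isNmodule.Build mquo mquo_addA mquo_addC mquo_add0.

Lemma mquo_pi0 : mquo_pi 0 = 0. Proof. by []. Qed.

Lemma mquo_piD x y : mquo_pi (x + y) = mquo_pi x + mquo_pi y.
Proof. by rewrite [RHS]mquo_add_pi. Qed.

Lemma mquo_pi_surj (p : mquo) : exists x, p = mquo_pi x.
Proof. by exists (repr p); rewrite mquo_reprK. Qed.

End QuotientMonoid.

(* The group completion of a commutative monoid: formal differences [x] - [y],
   encoded as pairs (x, y). *)
Section GroupCompletion.
Variable M : nmodType.

Definition gcomp_rel (x y : M * M) : bool :=
  `[< exists k : M, x.1 + y.2 + k = y.1 + x.2 + k >].

Lemma gcomp_rel_equiv : equiv_class_of gcomp_rel.
Proof.
split=> [x|x y|y x z].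
- by apply/asboolP; exists 0.
- by apply/asboolP/asboolP=> -[k e]; exists k.
- move=> /asboolP[k e1] /asboolP[l e2].
  apply/asboolP; exists (y.1 + y.2 + k + l).
  rewrite [LHS](AC (2*4) ((1*4*5)*(3*2*6))) /= e1 e2.
  by rewrite (AC (3*3) ((4*2)*(1*5*3*6))).
Qed.

Canonical gcomp_equiv := EquivRelPack gcomp_rel_equiv.
Canonical gcomp_encModRel := defaultEncModRel gcomp_rel.

Definition gcomp := {eq_quot gcomp_rel}.
HB.instance Definition _ := EqQuotient.on gcomp.
HB.instance Definition _ := Choice.on gcomp.

Definition gcomp_pi (x : M * M) : gcomp := \pi_gcomp%qT x.

Lemma gcomp_piP (x y : M * M) : gcomp_pi x = gcomp_pi y <->
  exists k : M, x.1 + y.2 + k = y.1 + x.2 + k.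
Proof. by split=> [/eqquotP/asboolP//|h]; apply/eqquotP/asboolP. Qed.

Lemma gcomp_reprK (p : gcomp) : gcomp_pi (repr p) = p.
Proof. exact: reprK. Qed.

Definition gcomp_add (p q : gcomp) : gcomp := gcomp_pi (repr p + repr q).
Definition gcomp_opp (p : gcomp) : gcomp := gcomp_pi ((repr p).2, (repr p).1).

Lemma gcomp_add_pi x y : gcomp_add (gcomp_pi x) (gcomp_pi y) = gcomp_pi (x + y).
Proof.
have /gcomp_piP[k e1] := gcomp_reprK (gcomp_pi x).
have /gcomp_piP[l e2] := gcomp_reprK (gcomp_pi y).
apply/gcomp_piP; exists (k + l) => /=.
rewrite [X in X + (k + l) = _]addrACA [LHS]addrACA e1 e2.
by rewrite [LHS]addrACA; congr (_ + _); rewrite addrACA.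
Qed.

Lemma gcomp_opp_pi x : gcomp_opp (gcomp_pi x) = gcomp_pi (x.2, x.1).
Proof.
have /gcomp_piP[k e1] := gcomp_reprK (gcomp_pi x).
apply/gcomp_piP; exists k => /=.
by rewrite [_ + x.1]addrC -e1 [x.2 + _]addrC.
Qed.

Lemma gcomp_addA : associative gcomp_add.
Proof.
move=> p q r; rewrite -(gcomp_reprK p) -(gcomp_reprK q) -(gcomp_reprK r).
by rewrite !gcomp_add_pi addrA.
Qed.

Lemma gcomp_addC : commutative gcomp_add.
Proof.
move=> p q; rewrite -(gcomp_reprK p) -(gcomp_reprK q).
by rewrite !gcomp_add_pi addrC.
Qed.

Lemma gcomp_add0 : left_id (gcomp_pi 0) gcomp_add.
Proof. by move=> p; rewrite -(gcomp_reprK p) gcomp_add_pi add0r. Qed.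

Lemma gcomp_addN : left_inverse (gcomp_pi 0) gcomp_opp gcomp_add.
Proof.
move=> p; rewrite -(gcomp_reprK p) gcomp_opp_pi gcomp_add_pi.
by apply/gcomp_piP; exists 0; rewrite /= !addr0 add0r addrC.
Qed.

HB.instance Definition _ :=
  GRing.isZmodule.Build gcomp gcomp_addA gcomp_addC gcomp_add0 gcomp_addN.

Definition gcomp_of (x : M) : gcomp := gcomp_pi (x, 0).

Lemma gcomp_of0 : gcomp_of 0 = 0. Proof. by []. Qed.

Lemma gcomp_ofD x y : gcomp_of (x + y) = gcomp_of x + gcomp_of y.
Proof.
rewrite [RHS]gcomp_add_pi; congr gcomp_pi.
by apply/pair_equal_spec; split; rewrite //= addr0.
Qed.

Lemma gcomp_of_eqP x y :
  gcomp_of x = gcomp_of y <-> exists k, x + k = y + k.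
Proof.
split=> [/gcomp_piP[k]|[k e]]; first by rewrite /= !addr0; exists k.
by apply/gcomp_piP; exists k; rewrite /= !addr0.
Qed.

Lemma gcomp_ofB (p : gcomp) : exists x y, p = gcomp_of x - gcomp_of y.
Proof.
exists (repr p).1, (repr p).2; rewrite -[LHS]gcomp_reprK.
rewrite [- _]gcomp_opp_pi [RHS]gcomp_add_pi /=; congr gcomp_pi.
rewrite [LHS]surjective_pairing.
by apply/pair_equal_spec; split; rewrite //= ?addr0 ?add0r.
Qed.

End GroupCompletion.

Section GeneratedSubgroup.
Variables (V : zmodType) (A : V -> Prop).

Definition gen_subgroup : {pred V} := fun x =>
  `[< forall S : zmodClosed V, (forall a, A a -> a \in S) -> x \in S >].

Lemma gen_subgroup_zmod : zmod_closed gen_subgroup.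
Proof.
split=> [|x y]; first by apply/asboolP=> S _; apply: rpred0.
move=> /asboolP hx /asboolP hy; apply/asboolP=> S hS.
by rewrite rpredB ?hx ?hy.
Qed.

HB.instance Definition _ := GRing.isZmodClosed.Build V gen_subgroup
  gen_subgroup_zmod.

End GeneratedSubgroup.

Section Modules.
Variable R : comPzRingType.

Definition lmod_iso (M N : lmodType R) : Prop :=
  exists f : {linear M -> N}, bijective f.

Definition lin_comb (M : lmodType R) n (x : 'I_n -> M) (a : 'rV[R]_n) : M :=
  \sum_(i < n) a ord0 i *: x i.

Definition generates (M : lmodType R) n (x : 'I_n -> M) : Prop :=
  forall m : M, exists a : 'rV[R]_n, m = lin_comb x a.

Definition fin_gen (M : lmodType R) : Prop :=
  exists n (x : 'I_n -> M), generates x.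

Definition projective (M : lmodType R) : Prop :=
  forall (A B : lmodType R) (g : {linear A -> B}) (f : {linear M -> B}),
    (forall b, exists a, g a = b) ->
    exists h : {linear M -> A}, forall m, g (h m) = f m.

Definition fg_free (M : lmodType R) : Prop :=
  exists n, lmod_iso M 'rV[R]_n.

Lemma lin_comb_linear (M : lmodType R) n (x : 'I_n -> M) :
  linear (lin_comb x).
Proof.
move=> k a b; rewrite /lin_comb scaler_sumr -big_split /=.
by apply: eq_bigr=> i _; rewrite !mxE scalerDl scalerA.
Qed.

HB.instance Definition _ (M : lmodType R) n (x : 'I_n -> M) :=
  GRing.isLinear.Build R 'rV[R]_n M _ (lin_comb x) (lin_comb_linear x).

Lemma lmod_iso_of (M N : lmodType R) (f : M -> N) :
  linear f -> bijective f -> lmod_iso M N.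
Proof.
move=> lf bf.
pose F : {linear M -> N} := HB.pack f (GRing.isLinear.Build R M N _ f lf).
by exists F.
Qed.

Lemma lmod_iso_refl (M : lmodType R) : lmod_iso M M.
Proof. by apply: (@lmod_iso_of _ _ id) => //; exists id. Qed.

Lemma lmod_iso_sym (M N : lmodType R) : lmod_iso M N -> lmod_iso N M.
Proof.
move=> [f [g fK gK]]; apply: (@lmod_iso_of _ _ g); last by exists f.
by move=> k u v; apply: (can_inj fK); rewrite linearP !gK.
Qed.

Lemma lmod_iso_trans (M N Q : lmodType R) :
  lmod_iso M N -> lmod_iso N Q -> lmod_iso M Q.
Proof.
move=> [f bf] [g bg]; apply: (@lmod_iso_of _ _ (g \o f)).
  by move=> k u v; rewrite /= !linearP.
exact: bij_comp.
Qed.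

Lemma lmod_iso_prod (M M' N N' : lmodType R) :
  lmod_iso M M' -> lmod_iso N N' -> lmod_iso (M * N)%type (M' * N')%type.
Proof.
move=> [f [f' fK fK']] [g [g' gK gK']].
apply: (@lmod_iso_of _ _ (fun p : M * N => (f p.1, g p.2))).
  by move=> k [u1 u2] [v1 v2] /=; rewrite !linearP.
by exists (fun p => (f' p.1, g' p.2)) => -[a b] /=; rewrite ?fK ?gK ?fK' ?gK'.
Qed.

Lemma lmod_iso_prodA (M N Q : lmodType R) :
  lmod_iso (M * (N * Q))%type ((M * N) * Q)%type.
Proof.
apply: (@lmod_iso_of _ _ (fun p : M * (N * Q) => ((p.1, p.2.1), p.2.2))).
  by move=> k [u1 [u2 u3]] [v1 [v2 v3]].
by exists (fun p : (M * N) * Q => (p.1.1, (p.1.2, p.2))) => [[a [b c]]|[[a b] c]].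
Qed.

Lemma lmod_iso_prodC (M N : lmodType R) :
  lmod_iso (M * N)%type (N * M)%type.
Proof.
apply: (@lmod_iso_of _ _ (fun p : M * N => (p.2, p.1))).
  by move=> k [u1 u2] [v1 v2].
by exists (fun p : N * M => (p.2, p.1)) => -[a b].
Qed.

Lemma lmod_iso_prod0 (M : lmodType R) : lmod_iso ('rV[R]_0 * M)%type M.
Proof.
apply: (@lmod_iso_of _ _ (fun p : 'rV[R]_0 * M => p.2)).
  by move=> k [u1 u2] [v1 v2].
by exists (fun m => (0, m)) => // -[a b] /=; rewrite (thinmx0 a).
Qed.

Lemma lmod_iso_rV m n : lmod_iso ('rV[R]_m * 'rV[R]_n)%type 'rV[R]_(m + n).
Proof.
apply: (@lmod_iso_of _ _ (fun p : 'rV[R]_m * 'rV[R]_n => row_mx p.1 p.2)).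
  by move=> k [u1 u2] [v1 v2] /=; rewrite scale_row_mx add_row_mx.
exists (fun v => (lsubmx v, rsubmx v)) => [[a b]|v] /=.
  by rewrite row_mxKl row_mxKr.
by rewrite hsubmxK.
Qed.

Lemma lmod_iso_reg : lmod_iso R^o 'rV[R]_1.
Proof.
apply: (@lmod_iso_of _ _ (fun a : R^o => (a%:M : 'rV[R]_1))).
  by move=> k u v; apply/matrixP=> i j; rewrite !mxE !ord1 eqxx !mulr1n.
exists (fun v : 'rV[R]_1 => v 0 0 : R^o) => [a|v].
  by rewrite mxE eqxx mulr1n.
by rewrite [RHS]mx11_scalar.
Qed.

Lemma fin_gen_iso (M N : lmodType R) : lmod_iso M N -> fin_gen M -> fin_gen N.
Proof.
move=> [f [g fK gK]] [n [x hx]]; exists n, (f \o x) => m.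
have [a ea] := hx (g m); exists a.
by rewrite -[LHS]gK ea linear_sum; apply: eq_bigr=> i _; rewrite linearZ.
Qed.

Lemma projective_iso (M N : lmodType R) :
  lmod_iso M N -> projective M -> projective N.
Proof.
move=> [f [f' fK fK']] pM A B p q sp.
have [h eh] := pM A B p (q \o f)%FUN sp.
have lf' : linear f'.
  by move=> k u v; apply: (can_inj fK); rewrite linearP !fK'.
pose F : {linear N -> M} := HB.pack f' (GRing.isLinear.Build R N M _ f' lf').
by exists (h \o F)%FUN => m /=; rewrite eh /= fK'.
Qed.

Lemma rV_fin_gen n : fin_gen 'rV[R]_n.
Proof.
by exists n, (fun i => delta_mx 0 i) => m; exists m; rewrite [LHS]row_sum_delta.
Qed.

Lemma rV_projective n : projective 'rV[R]_n.
Proof.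
move=> A B g f sg.
have /choice[x ex] : forall i : 'I_n, exists a, g a = f (delta_mx 0 i).
  by move=> i; apply: sg.
exists (lin_comb x) => m.
rewrite [in RHS](row_sum_delta m) !linear_sum; apply: eq_bigr=> i _.
by rewrite !linearZ /= ex.
Qed.

Lemma prod_fin_gen (M N : lmodType R) :
  fin_gen M -> fin_gen N -> fin_gen (M * N)%type.
Proof.
move=> [m [x hx]] [n [y hy]]; exists (m + n)%N.
exists (fun i => match split i with inl j => (x j, 0) | inr j => (0, y j) end).
move=> [u v]; have [a ->] := hx u; have [b ->] := hy v.
exists (row_mx a b); rewrite [RHS]big_split_ord /=.
have sl i : split (lshift n i) = inl i :> 'I_m + 'I_n := unsplitK (inl i).
have sr i : split (rshift m i) = inr i :> 'I_m + 'I_n := unsplitK (inr i).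
under [X in _ = X + _]eq_bigr => i _ do rewrite row_mxEl sl.
under [X in _ = _ + X]eq_bigr => i _ do rewrite row_mxEr sr.
apply/pair_equal_spec; split; rewrite /= !raddf_sum /=.
  by rewrite [X in _ = _ + X]big1 ?addr0 // => i _; rewrite scaler0.
by rewrite [X in _ = X + _]big1 ?add0r // => i _; rewrite scaler0.
Qed.

Lemma prod_projective (M N : lmodType R) :
  projective M -> projective N -> projective (M * N)%type.
Proof.
move=> pM pN A B g f sg.
have l1 : linear (fun m : M => f (m, 0)).
  by move=> k u v; rewrite -linearP; congr (f _);
     apply/pair_equal_spec; split; rewrite //= scaler0 addr0.
have l2 : linear (fun m : N => f (0, m)).
  by move=> k u v; rewrite -linearP; congr (f _);
     apply/pair_equal_spec; split; rewrite //= scaler0 addr0.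
pose f1 : {linear M -> B} := HB.pack (fun m : M => f (m, 0)) (GRing.isLinear.Build R M B _ _ l1).
pose f2 : {linear N -> B} := HB.pack (fun m : N => f (0, m)) (GRing.isLinear.Build R N B _ _ l2).
have [h1 e1] := pM A B g f1 sg; have [h2 e2] := pN A B g f2 sg.
have l3 : linear (fun p : M * N => h1 p.1 + h2 p.2).
  by move=> k [u1 u2] [v1 v2] /=; rewrite !linearP scalerDr addrACA.
pose h : {linear (M * N)%type -> A} :=
  HB.pack (fun p : M * N => h1 p.1 + h2 p.2)
    (GRing.isLinear.Build R (M * N)%type A _ _ l3).
exists h => -[m n] /=; rewrite linearD e1 e2 /= -linearD; congr (f _).
by apply/pair_equal_spec; split; rewrite /= ?addr0 ?add0r.
Qed.

Lemma same_relations_iso (M N : lmodType R) n (x : 'I_n -> M) (y : 'I_n -> N) :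
  generates x -> generates y ->
  (forall a, lin_comb x a = 0 <-> lin_comb y a = 0) -> lmod_iso M N.
Proof.
move=> /choice[s sK] /choice[t tK] exy.
have hxy a b : lin_comb x a = lin_comb x b -> lin_comb y a = lin_comb y b.
  move/eqP; rewrite -subr_eq0 -linearB => /eqP/exy; rewrite linearB.
  by move/eqP; rewrite subr_eq0 => /eqP.
have hyx a b : lin_comb y a = lin_comb y b -> lin_comb x a = lin_comb x b.
  move/eqP; rewrite -subr_eq0 -linearB => /eqP/exy; rewrite linearB.
  by move/eqP; rewrite subr_eq0 => /eqP.
apply: (@lmod_iso_of _ _ (fun m => lin_comb y (s m))).
  by move=> k u v; rewrite -linearP; apply: hxy;
     rewrite -(sK (k *: u + v)) [RHS]linearP /= -(sK u) -(sK v).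
exists (fun m => lin_comb x (t m)) => m.
  by rewrite [RHS]sK; apply: hyx; rewrite -(tK (lin_comb y (s m))).
by rewrite [RHS]tK; apply: hxy; rewrite -(sK (lin_comb x (t m))).
Qed.

End Modules.

Record fgproj (R : comPzRingType) := FGProj {
  fgp_mod :> lmodType R;
  fgp_fin_gen : fin_gen fgp_mod;
  fgp_projective : projective fgp_mod }.

Section ProjectiveClasses.
Variable R : comPzRingType.

Definition fgproj_rV n : fgproj R :=
  FGProj (@rV_fin_gen R n) (@rV_projective R n).

Definition fgproj_reg : fgproj R :=
  FGProj (fin_gen_iso (lmod_iso_sym (lmod_iso_reg R)) (@rV_fin_gen R 1))
    (projective_iso (lmod_iso_sym (lmod_iso_reg R)) (@rV_projective R 1)).

Definition fgproj_sum (M N : fgproj R) : fgproj R :=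
  @FGProj R (M * N)%type
    (prod_fin_gen (@fgp_fin_gen R M) (@fgp_fin_gen R N))
    (prod_projective (@fgp_projective R M) (@fgp_projective R N)).

(* The isomorphism class of M cannot be the predicate "isomorphic to M" on
   modules: that predicate lives in a universe too large for it to be an
   element of an nmodType.  It is encoded by the collection of all submodules
   K of some R^n with R^n/K isomorphic to M, i.e. of all the modules of
   relations between finite generating families of M.  By iso_class_eqP this
   is a complete isomorphism invariant of finitely generated modules. *)
Definition presentations (M : lmodType R) :
    forall n : nat, ('rV[R]_n -> Prop) -> Prop :=
  fun n K => exists x : 'I_n -> M,
    generates x /\ K = (fun a => lin_comb x a = 0).

Definition projmon : Type :=
  {c : forall n : nat, ('rV[R]_n -> Prop) -> Prop |
    exists M : fgproj R, c = presentations M}.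

HB.instance Definition _ := gen_eqMixin projmon.
HB.instance Definition _ := gen_choiceMixin projmon.

Definition iso_class (M : fgproj R) : projmon :=
  exist _ (presentations M) (ex_intro _ M erefl).

Lemma iso_class_surj (c : projmon) : exists M, c = iso_class M.
Proof. by case: c => c [M e]; exists M; apply: eq_exist. Qed.

Lemma iso_class_eqP (M N : fgproj R) :
  iso_class M = iso_class N <-> lmod_iso M N.
Proof.
split=> [/(congr1 sval)/= e|[f [g fK gK]]].
  have [n [x hx]] := @fgp_fin_gen R M.
  have : presentations M (fun a => lin_comb x a = 0) by exists x.
  rewrite e => -[y [hy exy]]; apply: (same_relations_iso hx hy) => a.
  by rewrite -[lin_comb x a = 0]/((fun a => lin_comb x a = 0) a) exy.
have hf n (x : 'I_n -> M) a : lin_comb (f \o x) a = f (lin_comb x a).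
  by rewrite linear_sum; apply: eq_bigr => i _; rewrite linearZ.
apply: eq_exist; apply/functional_extensionality_dep => n.
apply/funext => K; apply/propext; split=> -[x [hx ->]].
  exists (f \o x); split.
    by move=> m; have [a ea] := hx (g m); exists a; rewrite hf -ea gK.
  apply/funext=> a; rewrite hf; apply/propext; split=> [->|]; first exact: linear0.
  by move=> e; apply: (can_inj fK); rewrite e linear0.
have ex : x = f \o (g \o x) by apply/funext=> i /=; rewrite gK.
exists (g \o x); split.
  move=> m; have [a ea] := hx (f m); exists a.
  by apply: (can_inj fK); rewrite ea -hf -ex.
apply/funext=> a; rewrite {1}ex hf; apply/propext; split=> [e|->].
  by apply: (can_inj fK); rewrite e linear0.
exact: linear0.
Qed.

Definition class_repr (c : projmon) : fgproj R := projT1 (cid (iso_class_surj c)).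

Lemma class_reprK c : iso_class (class_repr c) = c.
Proof. by rewrite /class_repr; case: cid. Qed.

Definition P_add (c d : projmon) : projmon :=
  iso_class (fgproj_sum (class_repr c) (class_repr d)).

Lemma P_add_class M N :
  P_add (iso_class M) (iso_class N) = iso_class (fgproj_sum M N).
Proof.
apply/iso_class_eqP; apply: lmod_iso_prod; apply/iso_class_eqP;
  exact: class_reprK.
Qed.

Lemma P_addA : associative P_add.
Proof.
move=> a b c; rewrite -(class_reprK a) -(class_reprK b) -(class_reprK c).
rewrite !P_add_class; apply/iso_class_eqP; exact: lmod_iso_prodA.
Qed.

Lemma P_addC : commutative P_add.
Proof.
move=> a b; rewrite -(class_reprK a) -(class_reprK b).
rewrite !P_add_class; apply/iso_class_eqP; exact: lmod_iso_prodC.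
Qed.

Lemma P_add0 : left_id (iso_class (fgproj_rV 0)) P_add.
Proof.
move=> a; rewrite -(class_reprK a).
rewrite !P_add_class; apply/iso_class_eqP; exact: lmod_iso_prod0.
Qed.

HB.instance Definition _ := GRing.isNmodule.Build projmon P_addA P_addC P_add0.

Lemma iso_class0 : iso_class (fgproj_rV 0) = 0. Proof. by []. Qed.

Lemma iso_classD M N :
  iso_class (fgproj_sum M N) = iso_class M + iso_class N.
Proof. by rewrite [RHS]P_add_class. Qed.

Definition freemon : {pred projmon} := fun c =>
  `[< exists M : fgproj R, fg_free M /\ c = iso_class M >].

Lemma F_addr_closed : addr_closed freemon.
Proof.
split=> [|c d /asboolP[M [[m fM] ->]] /asboolP[N [[n fN] ->]]]; apply/asboolP.
  by exists (fgproj_rV 0); split=> //; exists 0%N; apply: lmod_iso_refl.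
exists (fgproj_sum M N); split; last by rewrite iso_classD.
exists (m + n)%N; apply: lmod_iso_trans (lmod_iso_rV _ _ _).
exact: lmod_iso_prod.
Qed.

HB.instance Definition _ := GRing.isAddClosed.Build projmon freemon F_addr_closed.

Definition PC : nmodType := mquo freemon.

Definition K0 : zmodType := gcomp projmon.

Definition K0_class (M : fgproj R) : K0 := gcomp_of (iso_class M).

End ProjectiveClasses.

Arguments freemon : clear implicits.

(* Main.v *)
(* Every finitely generated projective P is a direct summand of some R^n, so
   F(R) is cofinal in P(R): each class has a complement in F(R), and hence
   P(R)/F(R) is a group.  For any cofinal submonoid N of a commutative monoid M
   the map x |-> [x] identifies M/N with the group completion of M modulo the
   subgroup of differences of elements of N.  Since [R^n] = n [R], that subgroup
   is the one generated by [R] when M = P(R) and N = F(R). *)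
Require Import Defs.
From HB Require Import structures.
From mathcomp Require Import all_boot all_algebra.
From mathcomp Require Import generic_quotient boolp.

Set Implicit Arguments.
Unset Strict Implicit.
Unset Printing Implicit Defensive.

Import GRing.Theory.
Local Open Scope ring_scope.

(** * Quotients by a cofinal submonoid *)

Section CofinalSubmonoid.
Variables (M : nmodType) (N : addrClosed M).
Hypothesis cofinalN : forall x : M, exists y : M, x + y \in N.

Lemma mquo_pi_eq0 (x : M) : x \in N -> mquo_pi N x = 0.
Proof.
move=> Nx; apply/mquo_piP; exists 0, x; split=> //; first exact: rpred0.
by rewrite addr0 add0r.
Qed.

Lemma mquo_cofinal_opp (p : mquo N) : exists q, p + q = 0.
Proof.
have [x ->] := mquo_pi_surj p; have [y Nxy] := cofinalN x.
by exists (mquo_pi N y); rewrite -mquo_piD mquo_pi_eq0.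
Qed.

Lemma mquo_cofinal_iso (S : zmodClosed (gcomp M)) :
  (forall z, z \in S <->
     exists a b, [/\ a \in N, b \in N & z = gcomp_of a - gcomp_of b]) ->
  exists f : {additive mquo N -> Quotient.quot S}, bijective f.
Proof.
move=> inS; pose pi (z : gcomp M) : Quotient.quot S := \pi_(Quotient.quot S)%qT z.
have pi_eq z t : pi z = pi t <-> z - t \in S.
  by rewrite Quotient.idealrBE; split=> [/eqP|/eqP].
have piD z t : pi (z + t) = pi z + pi t by rewrite /pi !piE.
pose f (p : mquo N) : Quotient.quot S := pi (gcomp_of (repr p)).
(* Independence of the representative: in the group completion, the chosen one differs from [x] by a
   difference of elements of [N], which lies in [S]. *)
have f_pi x : f (mquo_pi N x) = pi (gcomp_of x).
  have /mquo_piP[a [b [Na Nb e]]] := mquo_reprK (mquo_pi N x).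
  apply/pi_eq/inS; exists b, a; split=> //; apply/eqP.
  by rewrite subr_eq addrAC -subr_eq opprK -!gcomp_ofD e [b + x]addrC.
have f0 : f 0 = 0 by rewrite -mquo_pi0 f_pi gcomp_of0; exact: pi_zeror.
have fD : {morph f : p q / p + q}.
  move=> p q; have [x ->] := mquo_pi_surj p; have [y ->] := mquo_pi_surj q.
  by rewrite -mquo_piD !f_pi gcomp_ofD piD.
have f_inj : injective f.
  move=> p q; have [x ->] := mquo_pi_surj p; have [y ->] := mquo_pi_surj q.
  rewrite !f_pi => /pi_eq/inS[a [b [Na Nb]]] /eqP.
  rewrite subr_eq addrAC -subr_eq opprK -!gcomp_ofD.
  move=> /eqP/gcomp_of_eqP[k e].
  (* Equality in the group completion only holds after adding some [k] of [M]; a complement [l]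
     moves this term into [N]. *)
  have [l Nkl] := cofinalN k.
  apply/mquo_piP; exists (b + (k + l)), (a + (k + l)).
  split; [exact: rpredD..|].
  by rewrite !addrA e [a + y]addrC.
have f_surj : forall z, exists p, f p = z.
  move=> z; have [x [y e]] := gcomp_ofB (repr z).
  have [y' Nyy'] := cofinalN y; exists (mquo_pi N (x + y')).
  rewrite f_pi -[z]reprK e; apply/pi_eq/inS.
  exists (y + y'), 0; split=> //; first exact: rpred0.
  by rewrite gcomp_of0 subr0 [x + _]addrC !gcomp_ofD opprB addrACA subrr addr0 addrC.
have [g gK] := choice f_surj.
pose F : {additive mquo N -> Quotient.quot S} :=
  HB.pack f (GRing.isNmodMorphism.Build _ _ f (conj f0 fD)).
by exists F; exists g => // p; apply: f_inj; rewrite gK.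
Qed.

End CofinalSubmonoid.

(** * Kernels as modules *)

Section KernelModule.
Variables (R : comPzRingType) (M N : lmodType R) (f : {linear M -> N}).

Definition ker_pred : {pred M} := fun v => f v == 0.

Lemma ker_pred_submod : submod_closed ker_pred.
Proof.
split=> [|a u v]; rewrite !unfold_in ?linear0 // => /eqP fu /eqP fv.
by rewrite linearP fu fv scaler0 addr0.
Qed.

HB.instance Definition _ :=
  GRing.isSubmodClosed.Build R M ker_pred ker_pred_submod.

Record kermod := KerMod { ker_val : M; _ : ker_val \in ker_pred }.
HB.instance Definition _ := [isSub for ker_val].
HB.instance Definition _ := [Choice of kermod by <:].
HB.instance Definition _ := [SubChoice_isSubLmodule of kermod by <:].

End KernelModule.

(** * Retracts and the splitting they induce *)

Section Retracts.
Variables (R : comPzRingType) (M L : lmodType R).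
Variables (i : {linear M -> L}) (p : {linear L -> M}).
Hypothesis iK : cancel i p.

Lemma retract_fin_gen : fin_gen L -> fin_gen M.
Proof.
move=> [n [x hx]]; exists n, (p \o x) => m.
have [a ea] := hx (i m); exists a.
by rewrite -[LHS]iK ea linear_sum; apply: eq_bigr => k _; rewrite linearZ.
Qed.

Lemma retract_projective : projective L -> projective M.
Proof.
move=> pL A B g f sg; have [h hE] := pL A B g (f \o p)%FUN sg.
by exists (h \o i)%FUN => m; rewrite /= hE /= iK.
Qed.

Lemma retract_ker_sub v : v - i (p v) \in ker_pred p.
Proof. by rewrite unfold_in linearB /= iK subrr. Qed.

(** The idempotent [i \o p] splits [L]: each [v] is [i (p v)] plus [v - i (p v)], and [p] kills the
    second term. *)
Lemma retract_split : lmod_iso (M * kermod p)%type L.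
Proof.
apply: (@lmod_iso_of _ _ _ (fun q : M * kermod p => i q.1 + val q.2)).
  by move=> k [u1 u2] [v1 v2] /=; rewrite !linearP scalerDr addrACA.
exists (fun v => (p v, KerMod (retract_ker_sub v))) => [[m [v kv]]|v] /=; last first.
  by rewrite addrC subrK.
have pv : p v = 0 by apply/eqP.
have pE : p (i m + v) = m by rewrite linearD /= iK pv addr0.
by congr pair => //; apply: val_inj; rewrite /= pE addrC addKr.
Qed.

(** The complementary idempotent, sending [v] to [v - i (p v)], fixes the kernel pointwise. Hence
    the kernel too inherits finite generation and projectivity from [L]. *)
Lemma kermod_retract :
  exists (j : {linear kermod p -> L}) (q : {linear L -> kermod p}), cancel j q.
Proof.
pose q v := KerMod (retract_ker_sub v).
have lq : linear q.
  move=> k u v; apply: val_inj; rewrite /= !linearP /=.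
  by rewrite addrACA -scalerDr.
pose Q : {linear L -> kermod p} :=
  HB.pack q (GRing.isLinear.Build R L (kermod p) _ q lq).
exists (val : {linear kermod p -> L}), Q => -[v kv]; apply: val_inj => /=.
have -> : p v = 0 by apply/eqP.
by rewrite linear0 subr0.
Qed.

End Retracts.

(** * Free modules inside the monoid of projective classes *)

Section FreeClasses.
Variable R : comPzRingType.

Lemma fgproj_complement (M : fgproj R) :
  exists (N : fgproj R) n, lmod_iso (fgproj_sum M N) 'rV[R]_n.
Proof.
have [n [x hx]] := fgp_fin_gen M.
(* Projectivity lifts the identity of [M] along the surjection given by the generators [x]; the
   kernel of that surjection will be the complement. *)
have [h hE] : exists h : {linear M -> 'rV[R]_n}, forall m, lin_comb x (h m) = m.
  by apply: (@fgp_projective _ M _ _ (lin_comb x) idfun) => m;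
     have [a ->] := hx m; exists a.
pose p : {linear 'rV[R]_n -> M} := lin_comb x.
have hK : cancel h p by [].
have [j [q jK]] := kermod_retract hK.
exists (FGProj (retract_fin_gen jK (@rV_fin_gen R n))
               (retract_projective jK (@rV_projective R n))), n.
exact: retract_split hK.
Qed.

Lemma freemon_cofinal (c : projmon R) : exists d, c + d \in freemon R.
Proof.
have [M ->] := iso_class_surj c; have [N [n MNn]] := fgproj_complement M.
exists (iso_class N); apply/asboolP; exists (fgproj_sum M N).
by rewrite iso_classD; split=> //; exists n.
Qed.

Lemma iso_class_rV n :
  iso_class (fgproj_rV R n) = iso_class (fgproj_reg R) *+ n.
Proof.
elim: n => [|n IHn]; first exact: iso_class0.
rewrite mulrS -IHn -iso_classD; apply/esym/iso_class_eqP.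
apply: lmod_iso_trans (lmod_iso_rV R 1 n); apply: lmod_iso_prod.
  exact: lmod_iso_reg.
exact: lmod_iso_refl.
Qed.

Lemma freemonP (c : projmon R) :
  c \in freemon R <-> exists n, c = iso_class (fgproj_reg R) *+ n.
Proof.
split=> [/asboolP[M [[n Mn] ->]]|[n ->]].
  by exists n; rewrite -iso_class_rV; apply/iso_class_eqP.
apply/asboolP; exists (fgproj_rV R n); rewrite iso_class_rV; split=> //.
by exists n; apply: lmod_iso_refl.
Qed.

(** The differences of free classes form a subgroup [D] containing the class of [R], so [D] contains
    the generated subgroup. Conversely each such difference is [m] times that class minus [n] times
    it, hence lies in every subgroup containing it. *)
Lemma gen_subgroup_reg (z : K0 R) :
  z \in gen_subgroup (fun x : K0 R => x = K0_class (fgproj_reg R)) <->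
  exists a b, [/\ a \in freemon R, b \in freemon R &
                  z = gcomp_of a - gcomp_of b].
Proof.
pose D : {pred K0 R} := fun z => `[< exists a b, [/\ a \in freemon R,
  b \in freemon R & z = gcomp_of a - gcomp_of b] >].
have D_zmod : zmod_closed D.
  split=> [|x y /asboolP[a [b [Fa Fb ->]]] /asboolP[c [d [Fc Fd ->]]]];
    apply/asboolP.
    by exists 0, 0; rewrite subrr; split=> //; apply: rpred0.
  exists (a + d), (b + c); split; [exact: rpredD..|].
  by rewrite !gcomp_ofD opprB addrACA -opprD.
pose S : zmodClosed (K0 R) := HB.pack D (GRing.isZmodClosed.Build _ D D_zmod).
split=> [/asboolP/(_ S) zS|[a [b [/freemonP[m ->] /freemonP[n ->] ->]]]].
  apply/asboolP/zS => _ ->; apply/asboolP.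
  exists (iso_class (fgproj_reg R)), 0; split; last by rewrite gcomp_of0 subr0.
    by apply/freemonP; exists 1%N.
  exact: rpred0.
have ofMn k : gcomp_of (iso_class (fgproj_reg R) *+ k) =
    K0_class (fgproj_reg R) *+ k.
  by elim: k => [|k IHk]; rewrite ?gcomp_of0 // !mulrS gcomp_ofD IHk.
by apply/asboolP => T hT; rewrite !ofMn rpredB ?rpredMn ?hT.
Qed.

End FreeClasses.

Theorem proposition1 (R : comPzRingType) :
  (forall x : PC R, exists y : PC R, x + y = 0) /\
  (exists f : {additive PC R ->
                 Quotient.quot
                   (gen_subgroup
                      (fun x : K0 R => x = K0_class (fgproj_reg R)))},
     bijective f).
Proof.
split; first exact: mquo_cofinal_opp (@freemon_cofinal R).
apply: mquo_cofinal_iso; [exact: freemon_cofinal|exact: gen_subgroup_reg].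
Qed.
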